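(* (Minkowski inequality) For every $p \in \mathbb{N}$ (positive integer) and all $f, g \in L^p$, $$\| f+ g\|_p \leq \|f\|_p + \|g\|_p .$$
   Context: Setting. $X$ is a Dedekind complete vector lattice with an order unit $e$ (for every $x\in X$ there is a real $c>0$ with $|x|\le c e$). By the Maeda-Ogasawara-Vulikh theorem $X$ is lattice isomorphic to $C(\Omega)$, $\Omega$ compact and extremely disconnected, with $e$ corresponding to the constant function $1$; $X$ carries the corresponding pointwise multiplication, so it is a commutative $f$-algebra with unit $e$. $X^+$ denotes the set of elements $x\ge 0$, $x\neq 0$, and $\mathbb{R}^+=]0,+\infty[$. An $(o)$-sequence (in $X$ or $\mathbb{R}$) is a decreasing sequence with infimum $0$. $G$ is an infinite set, $\mathcal{A}$ an algebra of subsets of $G$, $\mu:\mathcal{A}\to[0,+\infty]$ a finitely additive measure, and $\mathcal{A}_b=\{B\in\mathcal{A}:\mu(B)<+\infty\}$. $\mathcal{F}$ is a fixed free filter of $\mathbb{N}$, i.e. a filter of subsets of $\mathbb{N}$ (not containing $\emptyset$) containing all cofinite sets. $(o_{\mathcal F})\lim_n x_n=x$ in $X$ means that there is an $(o)$-sequence $(\sigma_p)_p$ in $X$ with $\{n:|x_n-x|\le\sigma_p\}\in\mathcal{F}$ for every $p$. A function $f:G\to X$ is simple iff it has finite range and $f^{-1}(\{x\})\in\mathcal{A}$ for every $x\in X$. $L^*$ is the set of simple functions vanishing outside a set of finite measure; for $f=\sum_i c_i 1_{E_i}\in L^*$ (with the $E_i\in\mathcal{A}_b$ pairwise disjoint),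 $\int_G f\,d\mu=\sum_i c_i\mu(E_i)$ and $\int_A f\,d\mu=\int_G f1_A\,d\mu$ for $A\in\mathcal{A}$. Put $\iota(f)=\int_G|f|\,d\mu$ for $f\in L^*$. A sequence $(f_n)_n$ in $X^G$ $\mu$-converges to $f\in X^G$ iff there are $(o)$-sequences $(\varepsilon_p)_p$, $(\sigma_p)_p$ in $\mathbb{R}^+$ and sets $A_n^p\in\mathcal{A}$ with $A_n^p\supset\{t\in G:|f_n(t)-f(t)|\not\le\varepsilon_p e\}$ for all $n,p$ and $\{n:\mu(A_n^p)\le\sigma_p\}\in\mathcal{F}$ for all $p$. A sequence $(f_n)_n$ in $L^*$ is equi-absolutely continuous iff there is a real $\alpha>0$ such that: (1) for every $(o)$-sequence $(\sigma_p)_p$ in $\mathbb{R}^+$ there are an $(o)$-sequence $(w_p)_p$ in $X^+$ and sets $\Lambda^p\in\mathcal{F}$ with $\iota(\alpha f_n1_B)\le w_p$ whenever $n\in\Lambda^p$, $B\in\mathcal{A}$, $\mu(B)\le\sigma_p$; (2) there are an $(o)$-sequence $(r_m)_m$ in $X^+$ and sets $B_m\in\mathcal{A}_b$ with $\{n:\iota(\alpha f_n1_{G\setminus B_m})\le r_m\}\in\mathcal{F}$ for every $m$. A positive $f:G\to X$ is integrable iff there are an equi-absolutely continuous sequence $(f_n)_n$ in $L^*$, $\mu$-convergent to $f$, and a map $l:\mathcal{A}\to X$ with $(o_{\mathcal F})\lim_n\bigvee_{A\in\mathcal{A}}|\int_A f_n\,d\mu-l(A)|=0$; such $(f_n)_n$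 is called a defining sequence for $f$, and $\int_A f\,d\mu:=l(A)$ (independent of the defining sequence). A general $f:G\to X$ is integrable iff $f\vee0$ and $(-f)\vee0$ are, and its integral is the difference of the two integrals; a defining sequence for a general $f$ is a sequence satisfying the same conditions for $f$. For $p\in\mathbb{N}$, $f\in L^p$ iff $f,f^p$ are integrable and there is a common sequence $(f_n)_n$ such that $(f_n)_n$ is a defining sequence for $f$ and $(f_n^p)_n$ is a defining sequence for $f^p$. For $f\in L^p$, $$\|f\|_p:=\inf\Bigl\{\varepsilon>0:\int_G\Bigl(\frac{|f(t)|}{\varepsilon}\Bigr)^p d\mu(t)\le e\Bigr\}=\Bigl\|\int_G|f(t)|^p d\mu(t)\Bigr\|_e^{1/p},$$ where $\|x\|_e=\inf\{\varepsilon>0:|x|\le\varepsilon e\}$ for $x\in X$. *)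

(* Defs.v *)
From HB Require Import structures.
From mathcomp Require Export all_boot all_order all_algebra.
From mathcomp Require Export all_classical all_reals all_analysis.
Export Order.TTheory GRing.Theory Num.Theory.
Export numFieldNormedType.Exports.

Set Implicit Arguments.
Unset Strict Implicit.
Unset Printing Implicit Defensive.

Local Open Scope classical_set_scope.
Local Open Scope ring_scope.

(* Real vector lattices (Riesz spaces), on top of the partially ordered
   Z-modules of the library.  The binary suprema and infima are operations of
   the mixin: HB rejects a join of [Order.Lattice] and [GRing.Lmodule], since
   [realDomainType] already inherits from [latticeType] and [zmodType]. *)
HB.mixin Record isVectorLattice (R : realType) X
    of Num.POrderedZmodule X & GRing.Lmodule R X := {
  vl_lerD2r : forall z x y : X, x <= y -> x + z <= y + z;
  vl_scale_ge0 : forall (a : R) (x : X), 0 <= a -> 0 <= x -> 0 <= a *: x;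
  vjoin : X -> X -> X;
  vmeet : X -> X -> X;
  vjoinP : forall x y z : X, vjoin x y <= z <-> x <= z /\ y <= z;
  vmeetP : forall x y z : X, z <= vmeet x y <-> z <= x /\ z <= y }.

#[short(type="vectorLatticeType")]
HB.structure Definition VectorLattice (R : realType) :=
  { X of Num.POrderedZmodule X & GRing.Lmodule R X & isVectorLattice R X }.

Section vector_lattice.
Context {R : realType} {X : vectorLatticeType R}.

Definition vabs (x : X) : X := vjoin x (- x).

Definition vpos (x : X) : X := vjoin x 0.

Definition dedekind_complete : Prop :=
  forall S : set X, S !=set0 -> ubound S !=set0 -> supremums S !=set0.

Definition order_unit (e : X) : Prop :=
  forall x : X, exists2 c : R, 0 < c & vabs x <= c *: e.

End vector_lattice.
Arguments dedekind_complete {R} X.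

Definition extremely_disconnected (T : topologicalType) : Prop :=
  forall U : set T, open U -> open (closure U).

(* [Phi] is a lattice isomorphism of [X] onto C(Omega), with [e] sent to 1. *)
Record is_MOV_representation (R : realType) (X : vectorLatticeType R) (e : X)
    (Omega : topologicalType) (Phi : X -> Omega -> R) : Prop := {
  MOV_linear : forall (a : R) (x y : X) (w : Omega),
    Phi (a *: x + y) w = a * Phi x w + Phi y w;
  MOV_join : forall (x y : X) (w : Omega),
    Phi (vjoin x y) w = Num.max (Phi x w) (Phi y w);
  MOV_meet : forall (x y : X) (w : Omega),
    Phi (vmeet x y) w = Num.min (Phi x w) (Phi y w);
  MOV_inj : injective Phi;
  MOV_range : range Phi = [set u : Omega -> R | continuous u];
  MOV_unit : Phi e = cst 1 }.

Section multiplication.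
Context {R : realType} {X : vectorLatticeType R} {Omega : topologicalType}.
Variables (e : X) (Phi : X -> Omega -> R).

(* The default value 0 is never used when [Phi] is onto C(Omega). *)
Definition vmul (x y : X) : X :=
  xget 0 [set z : X | forall w : Omega, Phi z w = Phi x w * Phi y w].

Definition vexp (x : X) (n : nat) : X := iter n (vmul x) e.

End multiplication.

Section o_convergence.

Definition o_sequence (T : porderZmodType) (s : nat -> T) : Prop :=
  nonincreasing_seq s /\ infimums (range s) 0.

(* For [T := R] this is "(o)-sequence in ]0, +oo[", and for [T := X] it is
   "(o)-sequence in X^+", as [0 < x] means [x != 0] and [0 <= x]. *)
Definition pos_o_sequence (T : porderZmodType) (s : nat -> T) : Prop :=
  o_sequence s /\ forall p, 0 < s p.

Definition free_filter (F : set_system nat) : Prop :=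
  ProperFilter F /\ forall S : set nat, finite_set (~` S) -> F S.

Definition oF_lim {R : realType} {X : vectorLatticeType R}
    (F : set_system nat) (x_ : nat -> X) (x : X) : Prop :=
  exists2 s : nat -> X, o_sequence s &
    forall p, F [set n | vabs (x_ n - x) <= s p].

End o_convergence.

Section simple_integral.
Context {R : realType} {X : vectorLatticeType R}.
Context {d : measure_display} {G : algebraOfSetsType d}.
Variable mu : {content set G -> \bar R}.

Definition simple_fun (f : G -> X) : Prop :=
  finite_set (range f) /\ forall x : X, measurable (f @^-1` [set x]).

Definition Lstar (f : G -> X) : Prop :=
  simple_fun f /\
  exists B : set G, [/\ measurable B, (mu B < +oo)%E &
                        forall t, ~ B t -> f t = 0].

(* The representation of [f] used is the canonical one, with the E_i being the
   fibres of [f]; the fibre of 0, possibly of infinite measure, contributes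
   a multiple of 0. *)
Definition simple_integral (f : G -> X) : X :=
  \sum_(x \in range f) (fine (mu (f @^-1` [set x])) *: x).

Definition frestr (A : set G) (f : G -> X) : G -> X :=
  fun t => (\1_A t : R) *: f t.

Definition simple_integral_on (A : set G) (f : G -> X) : X :=
  simple_integral (frestr A f).

Definition iota_ (f : G -> X) : X := simple_integral (fun t => vabs (f t)).

End simple_integral.

Section integral.
Context {R : realType} {X : vectorLatticeType R}.
Context {d : measure_display} {G : algebraOfSetsType d}.
Variables (e : X) (mu : {content set G -> \bar R}) (F : set_system nat).

Definition mu_converges (f_ : nat -> G -> X) (f : G -> X) : Prop :=
  exists (eps sigma : nat -> R) (A : nat -> nat -> set G),
    [/\ pos_o_sequence eps, pos_o_sequence sigma,
        forall n p, measurable (A n p),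
        forall n p,
          [set t | ~ (vabs (f_ n t - f t) <= eps p *: e)] `<=` A n p &
        forall p, F [set n | (mu (A n p) <= (sigma p)%:E)%E]].

Definition equi_abs_continuous (f_ : nat -> G -> X) : Prop :=
  exists alpha : R,
  [/\ 0 < alpha,
      forall sigma : nat -> R, pos_o_sequence sigma ->
        exists (w : nat -> X) (Lambda : nat -> set nat),
          [/\ pos_o_sequence w,
              forall p, F (Lambda p) &
              forall (p n : nat) (B : set G),
                Lambda p n -> measurable B -> (mu B <= (sigma p)%:E)%E ->
                iota_ mu (frestr B (fun t => alpha *: f_ n t)) <= w p] &
      exists (r : nat -> X) (B : nat -> set G),
        [/\ pos_o_sequence r,
            forall m, measurable (B m) /\ (mu (B m) < +oo)%E &
            forall m, F [set n |
              iota_ mu (frestr (~` B m) (fun t => alpha *: f_ n t)) <= r m]]].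

(* [f_] is a defining sequence for [f], with limit set function [l]. *)
Definition defines (f_ : nat -> G -> X) (f : G -> X) (l : set G -> X) : Prop :=
  [/\ forall n, Lstar mu (f_ n),
      equi_abs_continuous f_,
      mu_converges f_ f &
      exists2 s : nat -> X,
        forall n, supremums [set y | exists2 A : set G, measurable A &
                      y = vabs (simple_integral_on mu A (f_ n) - l A)] (s n) &
        oF_lim F s 0].

Definition defining_sequence (f_ : nat -> G -> X) (f : G -> X) : Prop :=
  exists l : set G -> X, defines f_ f l.

Definition pos_integrable (f : G -> X) : Prop :=
  (forall t, 0 <= f t) /\ exists f_, defining_sequence f_ f.

(* The value for a set [A] in the algebra and a [pos_integrable] function;
   it is the default 0 if no defining sequence exists. *)
Definition pos_integral (A : set G) (f : G -> X) : X :=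
  xget 0 [set x | exists (f_ : nat -> G -> X) (l : set G -> X),
                    defines f_ f l /\ l A = x].

Definition vintegrable (f : G -> X) : Prop :=
  pos_integrable (fun t => vpos (f t)) /\
  pos_integrable (fun t => vpos (- f t)).

Definition vintegral (A : set G) (f : G -> X) : X :=
  pos_integral A (fun t => vpos (f t)) -
  pos_integral A (fun t => vpos (- f t)).

End integral.

Section Lp_space.
Context {R : realType} {X : vectorLatticeType R} {Omega : topologicalType}.
Context {d : measure_display} {G : algebraOfSetsType d}.
Variables (e : X) (Phi : X -> Omega -> R).
Variables (mu : {content set G -> \bar R}) (F : set_system nat).

Definition in_Lp (p : nat) (f : G -> X) : Prop :=
  [/\ vintegrable e mu F f,
      vintegrable e mu F (fun t => vexp e Phi (f t) p) &
      exists f_ : nat -> G -> X,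
        defining_sequence e mu F f_ f /\
        defining_sequence e mu F (fun n t => vexp e Phi (f_ n t) p)
                                 (fun t => vexp e Phi (f t) p)].

(* Meaningful for [f] in L^p only: [inf] and [vintegral] are total
   functions. *)
Definition Lp_norm (p : nat) (f : G -> X) : R :=
  inf [set eps : R | 0 < eps /\
    vintegral e mu F [set: G]
      (fun t => vexp e Phi (eps^-1 *: vabs (f t)) p) <= e].

End Lp_space.

(* Main.v *)
Require Import Defs.
From mathcomp Require Import ring lra.
Set Implicit Arguments.
Unset Strict Implicit.
Unset Printing Implicit Defensive.

Local Open Scope classical_set_scope.
Local Open Scope ring_scope.

(** Minkowski's inequality follows from the convexity of the p-th power rather
    than from Hoelder's inequality.  If [a] and [b] are admissible in the
    infima defining the norms of [f] and [g], then pointwise on Omega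

      (|f + g| / (a + b))^p
        <= a / (a + b) * (|f| / a)^p + b / (a + b) * (|g| / b)^p,

    and integrating bounds the left-hand side by [e]: so [a + b] is admissible
    for [f + g] ([norm_boundsD]).  All inequalities of X are checked pointwise,
    through the representation [Phi] ([Phi_le]).

    The integral is a limit, so the work lies in integrating that inequality.
    Given sequences [u] for [f] and [v] for [g], it holds for the simple
    functions [u n] and [v n], where the integral is plainly monotone, and it
    passes to order limits ([vintegral_le_lin]), provided that the three
    sequences of p-th powers define the three limit functions.

    That proviso, like the membership of [f + g] in L^p, rests on a Vitali
    theorem ([vitali_seq_defining]): a sequence of simple functions that is
    equi-absolutely continuous and converges in measure is a defining sequence;
    the existence of the limit of the integrals comes for free.  Its core is
    [vitali_seq_close]: if [u] and [v] both converge to [f], then the integrals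
    of [u n] and [v m] over any set differ by little.  Indeed, off the small set
    where [u n] or [v m] is far from [f] and inside a set of finite measure,
    [u n - v m] is uniformly small, and elsewhere both integrals are small by
    equi-absolute continuity.  Taking [v = u] gives a Cauchy property, hence a
    limit by Dedekind completeness ([order_complete_limit]); two different
    sequences give the independence of the integral from the defining sequence
    ([pos_integral_lim]).

    It remains to see that the sequences at hand satisfy the hypotheses of the
    Vitali theorem.  Equi-absolute continuity passes to dominated sequences
    ([eac_dom]), here through |x + y|^p <= 2^p (|x|^p + |y|^p).  Convergence in
    measure passes through sums, and through locally Lipschitz maps such as
    powers ([cvm_comp]), because a limit in measure of bounded functions is
    bounded off a set of small measure. *)

(** * Pointwise calculus in X *)

Section representation.
Context {R : realType} {X : vectorLatticeType R} {e : X}.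
Context {Omega : topologicalType} {Phi : X -> Omega -> R}.
Context (Phi_MOV : is_MOV_representation e Phi).
Implicit Types x y z : X.

Lemma Phi_le x y : x <= y <-> forall w, Phi x w <= Phi y w.
Proof.
have [jx jy] : x <= vjoin x y /\ y <= vjoin x y by apply/vjoinP.
split=> [xy w|xy].
  have -> : y = vjoin x y.
    by apply/le_anti/andP; split => //; apply/vjoinP; split.
  by rewrite (MOV_join Phi_MOV) le_max lexx.
suff <- : vjoin x y = y by [].
apply: (MOV_inj Phi_MOV); apply/funext => w.
by rewrite (MOV_join Phi_MOV); apply/max_r/xy.
Qed.

Lemma Phi_eq x y : (forall w, Phi x w = Phi y w) -> x = y.
Proof. by move=> xy; apply/(MOV_inj Phi_MOV)/funext. Qed.

Lemma Phi0 w : Phi 0 w = 0.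
Proof.
have := MOV_linear Phi_MOV (-1) 0 0 w.
by rewrite scaler0 addr0 mulN1r addNr.
Qed.

Lemma PhiD x y w : Phi (x + y) w = Phi x w + Phi y w.
Proof. by rewrite -[x in LHS]scale1r (MOV_linear Phi_MOV) mul1r. Qed.

Lemma PhiZ a x w : Phi (a *: x) w = a * Phi x w.
Proof. by rewrite -[_ *: _]addr0 (MOV_linear Phi_MOV) Phi0 addr0. Qed.

Lemma PhiN x w : Phi (- x) w = - Phi x w.
Proof. by rewrite -scaleN1r PhiZ mulN1r. Qed.

Lemma PhiB x y w : Phi (x - y) w = Phi x w - Phi y w.
Proof. by rewrite PhiD PhiN. Qed.

Lemma Phi1 w : Phi e w = 1.
Proof. by rewrite (MOV_unit Phi_MOV). Qed.

Lemma Phi_vabs x w : Phi (vabs x) w = `|Phi x w|.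
Proof. by rewrite (MOV_join Phi_MOV) PhiN -maxrN. Qed.

Lemma Phi_vpos x w : Phi (vpos x) w = Num.max (Phi x w) 0.
Proof. by rewrite (MOV_join Phi_MOV) Phi0. Qed.

Lemma Phi_vmul x y w : Phi (vmul Phi x y) w = Phi x w * Phi y w.
Proof.
have /(xgetPex 0) : exists z, forall w, Phi z w = Phi x w * Phi y w.
  have cPhi z : continuous (Phi z).
    have : range Phi (Phi z) by exists z.
    by rewrite (MOV_range Phi_MOV).
  have : [set u : Omega -> R | continuous u] (fun w => Phi x w * Phi y w).
    by move=> w0; apply: cvgM; apply: cPhi.
  by rewrite -(MOV_range Phi_MOV) => -[z _ zE]; exists z => w'; rewrite zE.
exact.
Qed.

Lemma Phi_vexp x n w : Phi (vexp e Phi x n) w = Phi x w ^+ n.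
Proof.
elim: n => [|n IHn]; first by rewrite /vexp /= Phi1 expr0.
by rewrite /vexp iterS Phi_vmul IHn exprS.
Qed.

Definition PhiE := (Phi0, PhiB, PhiD, PhiN, PhiZ, Phi1, Phi_vabs, Phi_vpos,
  Phi_vexp).

Lemma vle_add x y x' y' : x <= y -> x' <= y' -> x + x' <= y + y'.
Proof.
move=> /Phi_le xy /Phi_le xy'; apply/Phi_le => w.
by rewrite !PhiE lerD.
Qed.

Lemma vle_scale a x y : 0 <= a -> x <= y -> a *: x <= a *: y.
Proof.
move=> a0 /Phi_le xy; apply/Phi_le => w.
by rewrite !PhiE ler_wpM2l.
Qed.

Lemma vabs_dist x y z : vabs (x - z) <= vabs (x - y) + vabs (y - z).
Proof. by apply/Phi_le => w; rewrite !PhiE ler_distD. Qed.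

Lemma vabs_ge0 x : 0 <= vabs x.
Proof. by apply/Phi_le => w; rewrite !PhiE. Qed.

End representation.

(** * Simple functions and their integral *)

Section simple.
Context {d : measure_display} {G : algebraOfSetsType d}.

Definition simple_map (T : choiceType) (phi : G -> T) : Prop :=
  finite_set (range phi) /\ forall y, measurable (phi @^-1` [set y]).

Lemma preimage_comp_bigcup (T U : choiceType) (phi : G -> T) (psi : T -> U) y :
  (psi \o phi) @^-1` [set y] =
  \bigcup_(z in range phi `&` psi @^-1` [set y]) phi @^-1` [set z].
Proof.
apply/seteqP; split=> [t /= <-|t [z [_ /= <-] /= <-]]//.
by exists (phi t) => //; split => //; exists t.
Qed.

Lemma simple_comp (T U : choiceType) (phi : G -> T) (psi : T -> U) :
  simple_map phi -> simple_map (psi \o phi).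
Proof.
move=> [fphi mphi]; split=> [|y].
  rewrite -(image_comp phi psi setT); exact: finite_image.
rewrite preimage_comp_bigcup; apply: fin_bigcup_measurable => //.
exact: finite_setIl.
Qed.

Lemma simple_pair (T U : choiceType) (phi : G -> T) (psi : G -> U) :
  simple_map phi -> simple_map psi -> simple_map (fun t => (phi t, psi t)).
Proof.
move=> [fphi mphi] [fpsi mpsi]; split=> [|[y z]].
  apply: (@sub_finite_set _ _ (range phi `*` range psi)).
    by move=> _ [t _ <-]; split; exists t.
  exact: finite_setX.
have -> : (fun t => (phi t, psi t)) @^-1` [set (y, z)] =
    phi @^-1` [set y] `&` psi @^-1` [set z].
  by apply/seteqP; split=> [t [/= -> ->]|t [/= -> ->]].
exact: measurableI.
Qed.

Lemma simple_mem (A : set G) : measurable A -> simple_map (fun t => t \in A).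
Proof.
move=> mA; split=> [|b]; first exact: finite_finset.
case: b.
  have -> : (fun t => t \in A) @^-1` [set true] = A; last by [].
  by apply/seteqP; split=> t; [exact: set_mem|exact: mem_set].
have -> : (fun t => t \in A) @^-1` [set false] = ~` A; last exact: measurableC.
apply/seteqP; split=> t /=; first by move/negbT; rewrite notin_setE.
by move=> nAt; apply/negbTE; rewrite notin_setE.
Qed.

End simple.

Section simple_integral.
Context {R : realType} {X : vectorLatticeType R} {e : X}.
Context {Omega : topologicalType} {Phi : X -> Omega -> R}.
Context (Phi_MOV : is_MOV_representation e Phi).
Context {d : measure_display} {G : algebraOfSetsType d}.
Context {mu : {content set G -> \bar R}}.
Implicit Types f g h : G -> X.

Lemma fine_mu_fsum (T : choiceType) (phi : G -> T) (D : set T) :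
  finite_set D -> (forall y, D y -> measurable (phi @^-1` [set y])) ->
  (forall y, D y -> (mu (phi @^-1` [set y]) < +oo)%E) ->
  fine (mu (\bigcup_(y in D) phi @^-1` [set y])) =
  \sum_(y \in D) fine (mu (phi @^-1` [set y])).
Proof.
move=> fD mD oD; rewrite measure_fin_bigcup//; last first.
  by move=> y z _ _ [t [/= <- <-]].
have finE y : D y -> mu (phi @^-1` [set y]) = (fine (mu (phi @^-1` [set y])))%:E.
  by move=> Dy; rewrite fineK// ge0_fin_numE ?oD.
rewrite (eq_fsbigr (fun y => (fine (mu (phi @^-1` [set y])))%:E)); last first.
  by move=> y /set_mem; exact: finE.
by rewrite fsumEFin.
Qed.

(** The integral may be computed from any simple map [phi] through which the
    integrand factors.  With a pair of functions as [phi], whose fibres refine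
    those of both, linearity reduces to that of finite sums. *)
Lemma simple_integral_comp (T : choiceType) (phi : G -> T) (psi : T -> X) :
  simple_map phi ->
  (forall y, psi y != 0 -> (mu (phi @^-1` [set y]) < +oo)%E) ->
  simple_integral mu (psi \o phi) =
  \sum_(y \in range phi) (fine (mu (phi @^-1` [set y])) *: psi y).
Proof.
move=> sphi opsi; have [fphi mphi] := sphi.
have [fpp _] := simple_comp psi sphi.
pose c y := fine (mu (phi @^-1` [set y])).
pose D x := range phi `&` psi @^-1` [set x].
have fD x : finite_set (D x) by exact: finite_setIl.
rewrite /simple_integral.
transitivity (\sum_(x \in range (psi \o phi)) \sum_(y \in D x) c y *: psi y).
  apply: eq_fsbigr => x _.
  have [->|x0] := eqVneq x 0.
    by rewrite scaler0 fsbig1// => y [_ /= ->]; rewrite scaler0.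
  (* Additivity of [fine] needs finite measures, hence the case [x = 0] apart. *)
  rewrite preimage_comp_bigcup fine_mu_fsum//; first 1 last.
  - exact: fD.
  - by move=> y [_ /= yx]; apply: opsi; rewrite yx.
  have fDx := fD x; rewrite /D in fDx *.
  rewrite !fsbig_finite// scaler_suml !big_seq; apply: eq_bigr => y.
  by rewrite in_fset_set// => /set_mem[_ /= ->].
transitivity (\sum_(x \in range (psi \o phi)) \sum_(y \in range phi)
    (if y \in psi @^-1` [set x] then c y *: psi y else 0)).
  by apply: eq_fsbigr => x _; rewrite -fsbig_mkcondr.
rewrite exchange_fsbig//; apply: eq_fsbigr => y /set_mem[t _ <-{y}].
rewrite (fsbigD1 (psi (phi t)))//=; last by exists t.
rewrite ifT ?fsbig1 ?addr0//; last exact: mem_set.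
by move=> x [_ /= xt]; rewrite ifF//; apply/negbTE; rewrite notin_setE => /= /esym.
Qed.

Lemma mu_setU_lt A B : measurable A -> measurable B ->
  (mu A < +oo)%E -> (mu B < +oo)%E -> (mu (A `|` B) < +oo)%E.
Proof.
move=> mA mB oA oB; apply: le_lt_trans (lte_add_pinfty oA oB).
exact: measureU2.
Qed.

Lemma Lstar_pair f g : Lstar mu f -> Lstar mu g ->
  simple_map (fun t => (f t, g t)) /\
  forall y, y != 0 -> (mu ((fun t => (f t, g t)) @^-1` [set y]) < +oo)%E.
Proof.
move=> [sf [B [mB oB f0]]] [sg [C [mC oC g0]]].
have sfg := simple_pair sf sg; split=> // y y0; have [_ mfg] := sfg.
apply: le_lt_trans (mu_setU_lt mB mC oB oC); apply: le_measure.
- by rewrite inE; exact: mfg.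
- by rewrite inE; exact: measurableU.
move=> t /= ty; apply: contrapT => /not_orP[/f0 ft /g0 gt].
by move: y0; rewrite -ty ft gt eqxx.
Qed.

Lemma Lstar_comp2 f g (psi : X -> X -> X) : psi 0 0 = 0 ->
  Lstar mu f -> Lstar mu g -> Lstar mu (fun t => psi (f t) (g t)).
Proof.
move=> psi0 [sf [B [mB oB f0]]] [sg [C [mC oC g0]]]; split.
  exact: (simple_comp (fun y => psi y.1 y.2) (simple_pair sf sg)).
exists (B `|` C); split; [exact: measurableU|exact: mu_setU_lt|].
by move=> t /not_orP[/f0 -> /g0 ->].
Qed.

Lemma Lstar_comp f (psi : X -> X) : psi 0 = 0 ->
  Lstar mu f -> Lstar mu (fun t => psi (f t)).
Proof. by move=> psi0 Lf; apply: (Lstar_comp2 (psi := fun x _ => psi x) psi0 Lf Lf). Qed.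

Lemma frestrE A f t : frestr A f t = (t \in A)%:R *: f t.
Proof. by rewrite /frestr indicE. Qed.

Lemma Lstar_frestr A f : measurable A -> Lstar mu f -> Lstar mu (frestr A f).
Proof.
move=> mA [sf [B [mB oB f0]]]; split.
  have := simple_comp (fun y : bool * X => y.1%:R *: y.2)
    (simple_pair (simple_mem mA) sf).
  by congr simple_map; apply/funext => t; rewrite /= frestrE.
by exists B; split=> // t /f0 ft; rewrite frestrE ft scaler0.
Qed.

Lemma Lstar_indic A (x : X) : measurable A -> (mu A < +oo)%E ->
  Lstar mu (frestr A (fun=> x)).
Proof.
move=> mA oA; split.
  have := simple_comp (fun b : bool => b%:R *: x) (simple_mem mA).
  by congr simple_map; apply/funext => t; rewrite /= frestrE.
by exists A; split=> // t; rewrite frestrE -notin_setE => /negbTE ->; rewrite scale0r.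
Qed.

Lemma simple_integral_comp2 f g (psi : X -> X -> X) : psi 0 0 = 0 ->
  Lstar mu f -> Lstar mu g ->
  simple_integral mu (fun t => psi (f t) (g t)) =
  \sum_(y \in range (fun t => (f t, g t)))
    (fine (mu ((fun t => (f t, g t)) @^-1` [set y])) *: psi y.1 y.2).
Proof.
move=> psi0 Lf Lg; have [sfg ofg] := Lstar_pair Lf Lg.
apply: (simple_integral_comp (psi := fun y => psi y.1 y.2) sfg) => y y0.
by apply: ofg; apply: contra_neq y0 => ->.
Qed.

Lemma simple_integral_lin a b f g : Lstar mu f -> Lstar mu g ->
  simple_integral mu (fun t => a *: f t + b *: g t) =
  a *: simple_integral mu f + b *: simple_integral mu g.
Proof.
move=> Lf Lg; have [[ffg _] _] := Lstar_pair Lf Lg.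
rewrite (simple_integral_comp2 (psi := fun x y => a *: x + b *: y))//; last first.
  by rewrite !scaler0 addr0.
rewrite [simple_integral mu f](simple_integral_comp2 (psi := fun x y => x) _ Lf Lg)//.
rewrite [simple_integral mu g](simple_integral_comp2 (psi := fun x y => y) _ Lf Lg)//.
rewrite !fsbig_finite// !scaler_sumr -big_split/=; apply: eq_bigr => y _.
by rewrite scalerDr !scalerA [a * _]mulrC [b * _]mulrC.
Qed.

Lemma simple_integralZ a f : Lstar mu f ->
  simple_integral mu (fun t => a *: f t) = a *: simple_integral mu f.
Proof.
move=> Lf; have := simple_integral_lin a 0 Lf Lf.
rewrite scale0r addr0 => <-; congr simple_integral.
by apply/funext => t; rewrite scale0r addr0.
Qed.

Lemma simple_integralD f g : Lstar mu f -> Lstar mu g ->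
  simple_integral mu (fun t => f t + g t) =
  simple_integral mu f + simple_integral mu g.
Proof.
move=> Lf Lg; have := simple_integral_lin 1 1 Lf Lg.
rewrite !scale1r => <-; congr simple_integral.
by apply/funext => t; rewrite !scale1r.
Qed.

Lemma simple_integralB f g : Lstar mu f -> Lstar mu g ->
  simple_integral mu (fun t => f t - g t) =
  simple_integral mu f - simple_integral mu g.
Proof.
move=> Lf Lg; have := simple_integral_lin 1 (-1) Lf Lg.
rewrite !scale1r scaleN1r => <-; congr simple_integral.
by apply/funext => t; rewrite scale1r scaleN1r.
Qed.

Lemma simple_integral_ge0 f : (forall t, 0 <= f t) -> 0 <= simple_integral mu f.
Proof.
move=> f0; rewrite /simple_integral.
case: finite_supportP => [|A Af _ _]; first by rewrite big_nil.
rewrite big_seq; apply: (big_ind (fun x : X => 0 <= x)) => //.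
  by move=> x y x0 y0; rewrite -[0]addr0; exact: (vle_add Phi_MOV).
move=> x xA; have [|t _ <-] := Af x; first by [].
by apply: vl_scale_ge0 => //; exact: fine_ge0.
Qed.

Lemma simple_integral_le f g : Lstar mu f -> Lstar mu g ->
  (forall t, f t <= g t) -> simple_integral mu f <= simple_integral mu g.
Proof.
move=> Lf Lg fg; have : 0 <= simple_integral mu (fun t => g t - f t).
  apply: simple_integral_ge0 => t; apply/(Phi_le Phi_MOV) => w.
  by move/(Phi_le Phi_MOV)/(_ w): (fg t); rewrite !(PhiE Phi_MOV) subr_ge0.
rewrite simple_integralB// => /(Phi_le Phi_MOV) h; apply/(Phi_le Phi_MOV) => w.
by move: (h w); rewrite !(PhiE Phi_MOV) subr_ge0.
Qed.

Lemma simple_integral_indic A (x : X) : measurable A -> (mu A < +oo)%E ->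
  simple_integral mu (frestr A (fun=> x)) = fine (mu A) *: x.
Proof.
move=> mA oA.
have preA : (fun t => t \in A) @^-1` [set true] = A.
  by apply/seteqP; split=> t; [exact: set_mem|exact: mem_set].
have -> : frestr A (fun=> x) = (fun b : bool => b%:R *: x) \o (fun t => t \in A).
  by apply/funext => t; rewrite frestrE.
rewrite simple_integral_comp; [|exact: simple_mem|]; last first.
  by case; rewrite ?preA// scale0r eqxx.
rewrite (@fsbig_fwiden _ _ _ _ [:: true; false])//.
- by rewrite !big_cons big_nil preA scale1r scale0r scaler0 /= !addr0.
- by case.
- move=> b [_ bA] /=; rewrite (_ : _ @^-1` _ = set0) ?measure0 ?scale0r//.
  by apply/seteqP; split=> t //= tb; apply: bA; exists t.
Qed.

Lemma Lstar_vabs f : Lstar mu f -> Lstar mu (fun t => vabs (f t)).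
Proof.
apply: Lstar_comp; apply: (Phi_eq Phi_MOV) => w.
by rewrite !(PhiE Phi_MOV) normr0.
Qed.

Lemma simple_integral_vabs f : Lstar mu f ->
  vabs (simple_integral mu f) <= iota_ mu f.
Proof.
move=> Lf; have La := Lstar_vabs Lf.
have Ln : Lstar mu (fun t => - f t) by apply: Lstar_comp => //; rewrite oppr0.
apply/vjoinP; split.
  apply: simple_integral_le => // t.
  by apply/(Phi_le Phi_MOV) => w; rewrite !(PhiE Phi_MOV) ler_norm.
have -> : - simple_integral mu f = simple_integral mu (fun t => - f t).
  rewrite -scaleN1r -simple_integralZ//; congr simple_integral.
  by apply/funext => t; rewrite scaleN1r.
apply: simple_integral_le => // t.
by apply/(Phi_le Phi_MOV) => w; rewrite !(PhiE Phi_MOV) -normrN ler_norm.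
Qed.

Lemma vabs_frestr A f t : vabs (frestr A f t) = (t \in A)%:R *: vabs (f t).
Proof.
apply: (Phi_eq Phi_MOV) => w; rewrite frestrE !(PhiE Phi_MOV) normrM.
by rewrite ger0_norm.
Qed.

Lemma iota_frestrZ A a f : 0 <= a -> measurable A -> Lstar mu f ->
  iota_ mu (frestr A (fun t => a *: f t)) = a *: iota_ mu (frestr A f).
Proof.
move=> a0 mA Lf; rewrite -simple_integralZ; last first.
  by apply: Lstar_vabs; exact: Lstar_frestr.
congr simple_integral; apply/funext => t; rewrite !vabs_frestr.
by apply: (Phi_eq Phi_MOV) => w; rewrite !(PhiE Phi_MOV) normrM (ger0_norm a0) mulrCA.
Qed.

Lemma iota_frestr_dom A c f g h : 0 <= c -> measurable A ->
  Lstar mu f -> Lstar mu g -> Lstar mu h ->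
  (forall t, vabs (h t) <= c *: (vabs (f t) + vabs (g t))) ->
  iota_ mu (frestr A h) <= c *: (iota_ mu (frestr A f) + iota_ mu (frestr A g)).
Proof.
move=> c0 mA Lf Lg Lh hfg.
have Lr (k : G -> X) : Lstar mu k -> Lstar mu (fun t => vabs (frestr A k t)).
  by move=> Lk; by apply: Lstar_vabs; exact: Lstar_frestr.
rewrite scalerDr -simple_integral_lin; [|exact: Lr|exact: Lr].
apply: simple_integral_le; first exact: Lr.
  apply: (Lstar_comp2 (psi := fun x y => c *: x + c *: y) _ (Lr _ Lf) (Lr _ Lg)).
  by rewrite !scaler0 addr0.
move=> t; apply/(Phi_le Phi_MOV) => w; rewrite !vabs_frestr.
move/(Phi_le Phi_MOV)/(_ w): (hfg t); rewrite !(PhiE Phi_MOV) => hw.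
rewrite !(mulrCA c) -mulrDr -mulrDr; exact: ler_wpM2l.
Qed.

Lemma iota_frestr_sub A B f : A `<=` B -> measurable A -> measurable B ->
  Lstar mu f -> iota_ mu (frestr A f) <= iota_ mu (frestr B f).
Proof.
move=> AB mA mB Lf; apply: simple_integral_le; try (by apply: Lstar_vabs; exact: Lstar_frestr).
move=> t; apply/(Phi_le Phi_MOV) => w; rewrite !vabs_frestr !(PhiE Phi_MOV).
have [/set_mem/AB/mem_set ->//|_] := boolP (t \in A).
by rewrite mul0r mulr_ge0.
Qed.

End simple_integral.

(** * Order sequences and order limits along a filter *)

Lemma o_sequenceP (T : porderZmodType) (s : nat -> T) :
  o_sequence s <-> [/\ nonincreasing_seq s, forall p, 0 <= s p &
                       forall z, (forall p, z <= s p) -> z <= 0].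
Proof.
split=> [[ns [ls us]]|[ns s0 us]].
  split=> // [p|z zs]; first by apply: ls; exists p.
  by apply: us => _ [p _ <-]; exact: zs.
split=> //; split=> [_ [p _ <-]//|z zs].
by apply: us => p; apply: zs; exists p.
Qed.

Lemma exists_harmonic_lt (R : realType) (c z : R) :
  0 < z -> exists p : nat, c * p.+1%:R^-1 < z.
Proof.
move=> z0; exists (Num.truncn (c / z)).
by rewrite ltr_pdivrMr// mulrC -ltr_pdivrMr// truncnS_gt.
Qed.

Lemma pos_o_sequence_harmonic (R : realType) (c : R) :
  0 < c -> pos_o_sequence (fun p : nat => c * p.+1%:R^-1).
Proof.
move=> c0; have h0 p : 0 < c * (p.+1%:R : R)^-1 by rewrite divr_gt0.
split=> //; apply/o_sequenceP; split=> [m n mn|p|z zh].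
- by rewrite ler_pM2l// lef_pV2 ?posrE// ler_nat.
- exact/ltW.
- rewrite leNgt; apply/negP => /(exists_harmonic_lt c)[p].
  by rewrite ltNge zh.
Qed.

Lemma pos_o_sequence_lt (R : realType) (s : nat -> R) (z : R) :
  o_sequence s -> 0 < z -> exists p, s p < z.
Proof.
move=> /o_sequenceP[_ _ us] z0; apply: contrapT => /forallNP ns.
have : z <= 0 by apply: us => p; rewrite leNgt; exact/negP.
by rewrite leNgt z0.
Qed.

Section order_limits.
Context {R : realType} {X : vectorLatticeType R} {e : X}.
Context {Omega : topologicalType} {Phi : X -> Omega -> R}.
Context (Phi_MOV : is_MOV_representation e Phi).
Context {F : set_system nat} {FF : ProperFilter F}.
Implicit Types (s r : nat -> X) (x y z : X).

Lemma vle_subr x y z : x <= y + z <-> x - z <= y.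
Proof.
split=> /(Phi_le Phi_MOV) h; apply/(Phi_le Phi_MOV) => w; move: (h w);
  by rewrite !(PhiE Phi_MOV) lerBlDr.
Qed.

Lemma o_sequenceD s r : o_sequence s -> o_sequence r ->
  o_sequence (fun p => s p + r p).
Proof.
move=> /o_sequenceP[ns s0 us] /o_sequenceP[nr r0 ur].
apply/o_sequenceP; split=> [m n mn|p|z zsr].
- by apply: (vle_add Phi_MOV); [exact: ns|exact: nr].
- by rewrite -[0]addr0; exact: (vle_add Phi_MOV).
apply: ur => q; rewrite -[r q]add0r; apply/vle_subr/us => p.
apply/vle_subr/(le_trans (zsr (maxn p q))).
by apply: (vle_add Phi_MOV); [apply: ns|apply: nr]; rewrite ?leq_maxl ?leq_maxr.
Qed.

Lemma vle_pdivl (c : R) x y : 0 < c -> x <= c *: y <-> c^-1 *: x <= y.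
Proof.
by move=> c0; split=> /(Phi_le Phi_MOV) h; apply/(Phi_le Phi_MOV) => w; move: (h w);
  rewrite !(PhiE Phi_MOV) ler_pdivrMl.
Qed.

Lemma o_sequenceZ (c : R) s : 0 <= c -> o_sequence s ->
  o_sequence (fun p => c *: s p).
Proof.
rewrite le_eqVlt => /predU1P[<- _|c0 /o_sequenceP[ns s0 us]]; apply/o_sequenceP.
  split=> [m n mn|p|z]; rewrite ?scale0r//.
  by move/(_ 0%N); rewrite scale0r.
have c0' := ltW c0; split=> [m n mn|p|z zs].
- by apply: (vle_scale Phi_MOV) => //; exact: ns.
- exact: vl_scale_ge0.
rewrite -[0](scaler0 _ c); apply/(vle_pdivl _ _ c0)/us => p.
exact/(vle_pdivl _ _ c0).
Qed.

Lemma pos_o_sequenceD s r : pos_o_sequence s -> pos_o_sequence r ->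
  pos_o_sequence (fun p => s p + r p).
Proof.
move=> [os s0] [or r0]; split=> [|p]; first exact: o_sequenceD.
apply: (lt_le_trans (s0 p)); rewrite -[leLHS]addr0.
by apply: (vle_add Phi_MOV) => //; exact: ltW.
Qed.

Lemma pos_o_sequenceZ (c : R) s : 0 < c -> pos_o_sequence s ->
  pos_o_sequence (fun p => c *: s p).
Proof.
move=> c0 [os s0]; split=> [|p]; first by apply: o_sequenceZ => //; exact: ltW.
have := s0 p; rewrite !lt_def scaler_eq0 negb_or (gt_eqF c0) /= => /andP[sp0 sp].
by rewrite sp0 vl_scale_ge0// ltW.
Qed.

Lemma o_sequence_unit : o_sequence (fun p => p.+1%:R^-1 *: e).
Proof.
apply/o_sequenceP; split=> [m n mn|p|z zh]; apply/(Phi_le Phi_MOV) => w;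
  rewrite !(PhiE Phi_MOV) ?mulr1.
- by rewrite lef_pV2 ?posrE// ler_nat.
- by rewrite invr_ge0.
rewrite leNgt; apply/negP => /(exists_harmonic_lt 1)[p].
move/(Phi_le Phi_MOV)/(_ w): (zh p); rewrite !(PhiE Phi_MOV) mulr1 mul1r.
by rewrite ltNge => ->.
Qed.

Lemma oF_limD u v x y : oF_lim F u x -> oF_lim F v y ->
  oF_lim F (fun n => u n + v n) (x + y).
Proof.
move=> [s os us] [r or vr]; exists (fun p => s p + r p); first exact: o_sequenceD.
move=> p; apply: filterS2 (us p) (vr p) => n /= un vn.
apply: le_trans (vle_add Phi_MOV un vn); apply/(Phi_le Phi_MOV) => w.
by rewrite !(PhiE Phi_MOV) opprD addrACA ler_normD.
Qed.

Lemma oF_limZ (c : R) u x : oF_lim F u x -> oF_lim F (fun n => c *: u n) (c *: x).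
Proof.
move=> [s os us]; exists (fun p => `|c| *: s p); first exact: o_sequenceZ.
move=> p; apply: filterS (us p) => n /= /(Phi_le Phi_MOV) h.
apply/(Phi_le Phi_MOV) => w; move: (h w); rewrite !(PhiE Phi_MOV).
by rewrite -mulrBr normrM; exact: ler_wpM2l.
Qed.

Lemma oF_lim_le u v x y : (forall n, u n <= v n) ->
  oF_lim F u x -> oF_lim F v y -> x <= y.
Proof.
move=> uv [s os us] [r or vr].
have /o_sequenceP[_ _ inf0] := o_sequenceD os or.
suff : x - y <= 0 by move/vle_subr; rewrite add0r.
apply: inf0 => p.
have [n [/= /(Phi_le Phi_MOV) un /(Phi_le Phi_MOV) vn]] := filter_ex (filterI (us p) (vr p)).
apply/(Phi_le Phi_MOV) => w; move/(Phi_le Phi_MOV)/(_ w) : (uv n).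
move: (un w) (vn w); rewrite !(PhiE Phi_MOV) !ler_norml => /andP[? ?] /andP[? ?] ?.
lra.
Qed.

End order_limits.

(** * Equi-absolute continuity and convergence in measure *)

Section convergence_defs.
Context {R : realType} {X : vectorLatticeType R}.
Context {d : measure_display} {G : algebraOfSetsType d}.
Variables (e : X) (mu : {content set G -> \bar R}) (F : set_system nat).
Implicit Types (f g : G -> X) (u v : nat -> G -> X).

(** Equi-absolute continuity with the scaling factor equal to 1: the bounds can
    absorb any other factor ([eacP]), and sequences with different factors can
    then be compared. *)
Definition eac u : Prop :=
  (forall sigma : nat -> R, pos_o_sequence sigma ->
    exists (w : nat -> X) (Lambda : nat -> set nat),
      [/\ pos_o_sequence w, forall p, F (Lambda p) &
          forall p n (B : set G),
            Lambda p n -> measurable B -> (mu B <= (sigma p)%:E)%E ->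
            iota_ mu (frestr B (u n)) <= w p]) /\
  exists (r : nat -> X) (B : nat -> set G),
    [/\ pos_o_sequence r,
        forall m, measurable (B m) /\ (mu (B m) < +oo)%E &
        forall m, F [set n | iota_ mu (frestr (~` B m) (u n)) <= r m]].

Definition close_off (eps del : R) f g : Prop :=
  exists A, [/\ measurable A, (mu A <= del%:E)%E &
    forall t, ~ A t -> vabs (f t - g t) <= eps *: e].

(** Convergence in measure in epsilon-delta form; it frees the arguments below
    from choosing exceptional sets for all indices at once. *)
Definition cvm u f : Prop := forall eps del : R, 0 < eps -> 0 < del ->
  F [set n | close_off eps del (u n) f].

Definition locally_lipschitz (psi : X -> X) : Prop :=
  forall M : R, 0 <= M -> exists2 L : R, 0 < L & forall x y,
    vabs x <= M *: e -> vabs y <= M *: e ->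
    vabs (psi x - psi y) <= L *: vabs (x - y).

(** The hypotheses of the Vitali theorem; they are those of a defining sequence
    minus the convergence of the integrals. *)
Definition vitali_seq u f : Prop :=
  [/\ forall n, Lstar mu (u n), eac u & cvm u f].

End convergence_defs.

Section convergence.
Context {R : realType} {X : vectorLatticeType R} {e : X}.
Context {Omega : topologicalType} {Phi : X -> Omega -> R}.
Context (Phi_MOV : is_MOV_representation e Phi).
Context (e_unit : order_unit e).
Context {d : measure_display} {G : algebraOfSetsType d}.
Context {mu : {content set G -> \bar R}}.
Context {F : set_system nat} {FF : ProperFilter F}.
Implicit Types (f g : G -> X) (u v : nat -> G -> X).

Lemma eacP u : (forall n, Lstar mu (u n)) ->
  equi_abs_continuous mu F u <-> eac mu F u.
Proof.
move=> Lu; split=> [[a [a0 ac [r [B [or mB rB]]]]]|[ac tight]]; last first.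
  have u1 n : (fun t => 1 *: u n t) = u n by apply/funext => t; rewrite scale1r.
  exists 1; split=> // [sigma /ac[w [L [ow FL wL]]]|].
    by exists w, L; split=> // p n A *; rewrite u1; exact: wL.
  have [r [B [or mB rB]]] := tight.
  by exists r, B; split=> // m; apply: filterS (rB m) => n /=; rewrite u1.
have a'0 : 0 < a^-1 by rewrite invr_gt0.
have scale (x y : X) : a *: x <= y -> x <= a^-1 *: y.
  by move=> axy; apply/(vle_pdivl Phi_MOV _ _ a'0); rewrite invrK.
split=> [sigma /ac[w [L [ow FL wL]]]|].
  exists (fun p => a^-1 *: w p), L; split=> //; first exact: (pos_o_sequenceZ Phi_MOV).
  move=> p n A Ln mA sA; apply: scale.
  by rewrite -(iota_frestrZ Phi_MOV) ?(ltW a0)//; exact: wL.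
exists (fun p => a^-1 *: r p), B; split=> //; first exact: (pos_o_sequenceZ Phi_MOV).
move=> m; apply: filterS (rB m) => n /= h; apply: scale.
rewrite -(iota_frestrZ Phi_MOV) ?(ltW a0)//; apply: measurableC.
by have [] := mB m.
Qed.

(** Smallness of the integrals of [u n] and [v n] over a set is inherited by
    every sequence they dominate.  The sets outside of which the mass is small
    are joined. *)
Lemma eac_dom (c : R) u v (h_ : nat -> G -> X) : 0 < c ->
  (forall n, Lstar mu (u n)) -> (forall n, Lstar mu (v n)) ->
  (forall n, Lstar mu (h_ n)) ->
  (forall n t, vabs (h_ n t) <= c *: (vabs (u n t) + vabs (v n t))) ->
  eac mu F u -> eac mu F v -> eac mu F h_.
Proof.
move=> c0 Lu Lv Lh huv [acu [r [B [or mB rB]]]] [acv [r' [B' [or' mB' rB']]]].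
have dom n A : measurable A -> iota_ mu (frestr A (h_ n)) <=
    c *: (iota_ mu (frestr A (u n)) + iota_ mu (frestr A (v n))).
  by move=> mA; apply: (iota_frestr_dom Phi_MOV) => //; exact: ltW.
split=> [sigma os|].
  have [w [L [ow FL wL]]] := acu _ os.
  have [w' [L' [ow' FL' wL']]] := acv _ os.
  exists (fun p => c *: (w p + w' p)), (fun p => L p `&` L' p); split=> [|p|].
  - by apply: (pos_o_sequenceZ Phi_MOV) => //; exact: (pos_o_sequenceD Phi_MOV).
  - exact: filterI.
  move=> p n A [Ln L'n] mA sA; apply: le_trans (dom _ _ mA) _.
  apply: (vle_scale Phi_MOV); first exact: ltW.
  by apply: (vle_add Phi_MOV); [exact: wL|exact: wL'].
exists (fun p => c *: (r p + r' p)), (fun p => B p `|` B' p); split=> [|m|m].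
- by apply: (pos_o_sequenceZ Phi_MOV) => //; exact: (pos_o_sequenceD Phi_MOV).
- have [[mBm oBm] [mB'm oB'm]] := (mB m, mB' m).
  by split; [exact: measurableU|exact: mu_setU_lt].
have [[mBm _] [mB'm _]] := (mB m, mB' m).
have mC := measurableC (measurableU _ _ mBm mB'm).
apply: filterS2 (rB m) (rB' m) => n /= un vn.
apply: le_trans (dom _ _ mC) _; apply: (vle_scale Phi_MOV); first exact: ltW.
apply: (vle_add Phi_MOV).
  apply: le_trans un; apply: (iota_frestr_sub Phi_MOV) => //.
    by apply: subsetC; exact: subsetUl.
  exact: measurableC.
apply: le_trans vn; apply: (iota_frestr_sub Phi_MOV) => //.
  by apply: subsetC; exact: subsetUr.
exact: measurableC.
Qed.

Lemma vscale_unit_le (a b : R) : a <= b -> a *: e <= b *: e.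
Proof. by move=> ab; apply/(Phi_le Phi_MOV) => w; rewrite !(PhiE Phi_MOV) !mulr1. Qed.

Lemma cvmP u f : mu_converges e mu F u f <-> cvm e mu F u f.
Proof.
split=> [[eps [sigma [A [[oe e0] [os s0] mA badA FA]]]] ep de ep0 de0|uf].
  have [p epp] := pos_o_sequence_lt oe ep0.
  have [q sq] := pos_o_sequence_lt os de0.
  have /o_sequenceP[ne _ _] := oe; have /o_sequenceP[ns _ _] := os.
  apply: filterS (FA (maxn p q)) => n /= muA; exists (A n (maxn p q)); split=> //.
    apply: (le_trans muA); rewrite lee_fin; apply/(le_trans _ (ltW sq))/ns.
    exact: leq_maxr.
  move=> t nAt; apply: (@le_trans _ _ (eps (maxn p q) *: e)).
    by apply: contrapT => bad; apply: nAt; exact: badA.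
  apply: vscale_unit_le; apply/(le_trans _ (ltW epp))/ne; exact: leq_maxl.
pose H (p : nat) : R := 1 * p.+1%:R^-1.
have H0 p : 0 < H p by rewrite divr_gt0.
pose P n p (A : set G) := [/\ measurable A, (mu A <= (H p)%:E)%E &
    forall t, ~ A t -> vabs (u n t - f t) <= H p *: e].
(* Where no exceptional set of measure at most [H p] exists, the whole space
   serves; for given [p], the other indices [n] form a set in [F]. *)
exists H, H, (fun n p => xget setT (P n p)); split.
- exact: pos_o_sequence_harmonic.
- exact: pos_o_sequence_harmonic.
- by move=> n p; case: xgetP => [A _ []//|_]; exact: measurableT.
- move=> n p t /= bad; case: xgetP => [A _ [_ _ PA]|//].
  by apply: contrapT => /PA.
by move=> p; apply: filterS (uf _ _ (H0 p) (H0 p)) => n /= /(xgetPex setT)[].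
Qed.

Lemma cvm_add u v f g : cvm e mu F u f -> cvm e mu F v g ->
  cvm e mu F (fun n t => u n t + v n t) (fun t => f t + g t).
Proof.
move=> uf vg eps del e0 d0; have [e2 d2] : 0 < eps / 2 /\ 0 < del / 2 by lra.
apply: filterS2 (uf _ _ e2 d2) (vg _ _ e2 d2) => n /= [A [mA dA uA]] [B [mB dB vB]].
exists (A `|` B); split=> [||t]; first exact: measurableU.
  apply: (le_trans (measureU2 mu mA mB)); apply: (le_trans (leeD dA dB)).
  by rewrite -EFinD lee_fin -splitr.
move=> /not_orP[/uA /(Phi_le Phi_MOV) h /vB /(Phi_le Phi_MOV) k].
apply/(Phi_le Phi_MOV) => w; move: (h w) (k w); rewrite !(PhiE Phi_MOV) => hw kw.
rewrite opprD addrACA; apply: (le_trans (ler_normD _ _)).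
by apply: (le_trans (lerD hw kw)); rewrite !mulr1 -splitr.
Qed.

Lemma Lstar_bounded f : Lstar mu f ->
  exists M : R, forall t, vabs (f t) <= M *: e.
Proof.
move=> [[/finite_seqP[s fs] _] _].
suff [M Ms] : exists M : R, forall x, x \in s -> vabs x <= M *: e.
  exists M => t; apply: Ms; have : range f (f t) by exists t.
  by rewrite fs.
elim: {fs}s => [|x s [M Ms]]; first by exists 0.
have [c _ xc] := e_unit x; exists (Num.max c M) => y.
rewrite inE => /predU1P[->|/Ms yM].
  by apply: (le_trans xc); apply: vscale_unit_le; rewrite le_max lexx.
by apply: (le_trans yM); apply: vscale_unit_le; rewrite le_max lexx orbT.
Qed.

(** Powers are Lipschitz on bounded sets only, and [f] may be unbounded.  But a
    single [u n0] that is close to [f] off a small set is bounded, being simple;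
    this bounds [f], and then every [u n] close to [f], off a small set. *)
Lemma cvm_comp psi u f : (forall n, Lstar mu (u n)) -> locally_lipschitz e psi ->
  cvm e mu F u f -> cvm e mu F (fun n t => psi (u n t)) (fun t => psi (f t)).
Proof.
move=> Lu lpsi uf eps del e0 d0; have d2 : 0 < del / 2 by lra.
have [n0 [A0 [mA0 dA0 uA0]]] := filter_ex (uf 1 (del / 2) ltr01 d2).
have [M0 uM0] := Lstar_bounded (Lu n0).
pose M := `|M0| + 2; have M_ge0 : 0 <= M by rewrite addr_ge0.
have [L L0 psiL] := lpsi M M_ge0.
pose ep := Num.min 1 (eps / L).
have ep0 : 0 < ep by rewrite lt_min ltr01 divr_gt0.
apply: filterS (uf _ _ ep0 d2) => n /= [A [mA dA uA]].
exists (A `|` A0); split=> [||t]; first exact: measurableU.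
  apply: (le_trans (measureU2 mu mA mA0)); apply: (le_trans (leeD dA dA0)).
  by rewrite -EFinD lee_fin -splitr.
move=> /not_orP[nAt nA0t].
have /(Phi_le Phi_MOV) h := uA _ nAt; have /(Phi_le Phi_MOV) h0 := uA0 _ nA0t.
have /(Phi_le Phi_MOV) hM := uM0 t.
have bounds w : `|Phi (f t) w| <= M /\ `|Phi (u n t) w| <= M.
  move: (h w) (h0 w) (hM w); rewrite !(PhiE Phi_MOV) !mulr1 !ler_norml.
  have ep1 : ep <= 1 by rewrite ge_min lexx.
  have := ler_norm M0; rewrite /M; move=> ? /andP[? ?] /andP[? ?] /andP[? ?].
  by split; apply/andP; split; lra.
have [fM uM] : vabs (f t) <= M *: e /\ vabs (u n t) <= M *: e.
  by split; apply/(Phi_le Phi_MOV) => w; rewrite !(PhiE Phi_MOV) mulr1; have [] := bounds w.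
apply: (le_trans (psiL _ _ uM fM)); apply/(Phi_le Phi_MOV) => w.
move: (h w); rewrite !(PhiE Phi_MOV) !mulr1 => hw.
rewrite mulrC -ler_pdivlMr//; apply: (le_trans hw).
by rewrite ge_min lexx orbT.
Qed.

End convergence.

(** * A Vitali theorem *)

Section vitali.
Context {R : realType} {X : vectorLatticeType R} {e : X}.
Context {Omega : topologicalType} {Phi : X -> Omega -> R}.
Context (Phi_MOV : is_MOV_representation e Phi).
Context (X_complete : dedekind_complete X).
Context {d : measure_display} {G : algebraOfSetsType d}.
Context {mu : {content set G -> \bar R}}.
Context {F : set_system nat} {FF : ProperFilter F}.
Implicit Types (f g : G -> X) (u v : nat -> G -> X).

(** Off [B] and [B'], and on the exceptional sets [C] and [C'], the difference
    is bounded by the sum of the absolute values; at the remaining points both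
    functions are within [eps] of the third function [f]. *)
Lemma integral_dist_le f (u v : G -> X) (eps : R) (A B B' C C' : set G) :
  0 <= eps ->
  Lstar mu u -> Lstar mu v -> measurable A ->
  measurable B -> measurable B' -> (mu (B `|` B') < +oo)%E ->
  measurable C -> measurable C' ->
  (forall t, ~ C t -> vabs (u t - f t) <= eps *: e) ->
  (forall t, ~ C' t -> vabs (v t - f t) <= eps *: e) ->
  vabs (simple_integral_on mu A u - simple_integral_on mu A v) <=
    (iota_ mu (frestr (~` B) u) + iota_ mu (frestr (~` B') v)) +
    (iota_ mu (frestr (C `|` C') u) + iota_ mu (frestr (C `|` C') v)) +
    fine (mu (B `|` B')) *: ((2 * eps) *: e).
Proof.
move=> eps0 Lu Lv mA mB mB' oB mC mC' uC vC.
have mBB := measurableU _ _ mB mB'; have mCC := measurableU _ _ mC mC'.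
have LuA := Lstar_frestr mA Lu; have LvA := Lstar_frestr mA Lv.
have LD (h k : G -> X) : Lstar mu h -> Lstar mu k -> Lstar mu (fun t => h t + k t).
  by move=> Lh Lk; apply: (Lstar_comp2 (psi := +%R) _ Lh Lk); exact: addr0.
have Lr S (h : G -> X) : measurable S -> Lstar mu h ->
    Lstar mu (fun t => vabs (frestr S h t)).
  by move=> mS Lh; apply: (Lstar_vabs Phi_MOV); exact: Lstar_frestr.
have L1 := Lr _ _ (measurableC mB) Lu; have L2 := Lr _ _ (measurableC mB') Lv.
have L3 := Lr _ _ mCC Lu; have L4 := Lr _ _ mCC Lv.
have L5 := Lstar_indic ((2 * eps) *: e) mBB oB.
have LB : Lstar mu (fun t => frestr A u t - frestr A v t).
  by apply: (Lstar_comp2 (psi := fun x y => x - y) _ LuA LvA); exact: subr0.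
rewrite -(simple_integral_indic _ mBB oB) /iota_.
have L12 := LD _ _ L1 L2; have L34 := LD _ _ L3 L4; have L14 := LD _ _ L12 L34.
rewrite -!simple_integralD//.
rewrite /simple_integral_on -simple_integralB//.
apply: (le_trans (simple_integral_vabs Phi_MOV LB)).
apply: (simple_integral_le Phi_MOV); first exact: (Lstar_vabs Phi_MOV).
  exact: (LD _ _ L14 L5).
move=> t; apply/(Phi_le Phi_MOV) => w.
rewrite !(vabs_frestr Phi_MOV) !frestrE !(PhiE Phi_MOV) -mulrBr.
rewrite normrM ger0_norm// mulr1.
have i0 (b : bool) : 0 <= (b%:R : R) by [].
have i1 (b : bool) : b%:R <= 1 :> R by case: b.
set x := Phi (u t) w; set y := Phi (v t) w.
apply: (@le_trans _ _ `|x - y|); first by rewrite ler_piMl.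
have xy := ler_normB x y.
have [tC|tC] := boolP (t \in C `|` C').
  by rewrite !mul1r; have := mulr_ge0 (i0 (t \in ~` B)) (normr_ge0 x);
  have := mulr_ge0 (i0 (t \in ~` B')) (normr_ge0 y);
  have := mulr_ge0 (i0 (t \in B `|` B')) (mulr_ge0 (ler0n R 2) eps0); lra.
have [tB|tB] := boolP (t \in B `|` B'); last first.
  move: tB; rewrite in_setU negb_or => /andP[tB tB'].
  by rewrite !in_setC tB tB' /= !mul1r !mul0r !addr0.
move: tC; rewrite notin_setE => /not_orP[/uC /(Phi_le Phi_MOV)/(_ w) h].
move=> /vC /(Phi_le Phi_MOV)/(_ w) k; move: h k.
rewrite !(PhiE Phi_MOV) !mulr1 -/x -/y => h k.
have := ler_distD (Phi (f t) w) x y; rewrite (distrC (Phi (f t) w) y) => xfy.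
rewrite !mul0r !addr0 mul1r.
have := mulr_ge0 (i0 (t \in ~` B)) (normr_ge0 x).
have := mulr_ge0 (i0 (t \in ~` B')) (normr_ge0 y).
lra.
Qed.

(** The sets [B p] of finite measure are fixed before the accuracy of the
    convergence in measure, which can thus be chosen so fine that it outweighs
    the measure of [B p].  A single pair [s], [K] serves all sets [A]. *)
Lemma vitali_seq_close u v f : vitali_seq e mu F u f -> vitali_seq e mu F v f ->
  exists (s : nat -> X) (K : nat -> set nat),
    [/\ o_sequence s, forall p, F (K p) &
        forall p n m A, K p n -> K p m -> measurable A ->
          vabs (simple_integral_on mu A (u n) - simple_integral_on mu A (v m))
            <= s p].
Proof.
move=> [Lu [acu [r [B [or mB rB]]]] uf] [Lv [acv [r' [B' [or' mB' rB']]]] vf].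
(* The union of two exceptional sets, of measure at most 1 / (p + 1) each, has
   measure at most 2 / (p + 1). *)
have o2 := pos_o_sequence_harmonic (ltr0Sn R 1).
have [w [L [[ow _] FL wL]]] := acu _ o2.
have [w' [L' [[ow' _] FL' wL']]] := acv _ o2.
pose c p : R := fine (mu (B p `|` B' p)).
have c0 p : 0 <= c p by exact: fine_ge0.
pose eps p : R := p.+1%:R^-1 / (2 * (c p + 1)).
have eps0 p : 0 < eps p.
  by rewrite divr_gt0 ?mulr_gt0 ?invr_gt0// ltr_wpDl.
have ceps p : c p * (2 * eps p) <= p.+1%:R^-1.
  have hp : 0 < (p.+1%:R : R)^-1 by rewrite invr_gt0.
  have -> : c p * (2 * eps p) = p.+1%:R^-1 * (c p / (c p + 1)).
    rewrite /eps; field; rewrite [1 + _]addrC natr1 pnatr_eq0 andbT gt_eqF//.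
    by rewrite ltr_wpDl.
  have q1 : c p / (c p + 1) <= 1 by rewrite ler_pdivrMr ?mul1r ?lerDl// ltr_wpDl.
  by rewrite ler_piMr// ltW.
have h0 p : 0 < (p.+1%:R : R)^-1 by rewrite invr_gt0.
exists (fun p => ((r p + r' p) + (w p + w' p)) + p.+1%:R^-1 *: e).
exists (fun p => (L p `&` L' p) `&`
  ([set n | iota_ mu (frestr (~` B p) (u n)) <= r p] `&`
   [set n | iota_ mu (frestr (~` B' p) (v n)) <= r' p]) `&`
  ([set n | close_off e mu (eps p) p.+1%:R^-1 (u n) f] `&`
   [set n | close_off e mu (eps p) p.+1%:R^-1 (v n) f])).
split=> [|p|p n m A].
- have [[or0 _] [or'0 _]] := (or, or').
  apply: (o_sequenceD Phi_MOV); last exact: (o_sequence_unit Phi_MOV).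
  by apply: (o_sequenceD Phi_MOV); exact: (o_sequenceD Phi_MOV).
- by do !apply: filterI => //; [exact: uf|exact: vf].
move=> [[[Ln _] [/= ru _]] [[C [mC sC uC]] _]].
move=> [[[_ L'm] [/= _ rv]] [_ [C' [mC' sC' vC']]]] mA.
have [[mBp oBp] [mB'p oB'p]] := (mB p, mB' p).
have muC : (mu (C `|` C') <= (2 * p.+1%:R^-1)%:E)%E.
  apply: (le_trans (measureU2 mu mC mC')); apply: (le_trans (leeD sC sC')).
  by rewrite -EFinD lee_fin mulr_natl mulr2n.
have mCC := measurableU _ _ mC mC'.
apply: le_trans (integral_dist_le (ltW (eps0 p)) (Lu n) (Lv m) mA mBp mB'p
  (mu_setU_lt mBp mB'p oBp oB'p) mC mC' uC vC') _.
apply: (vle_add Phi_MOV).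
  by apply: (vle_add Phi_MOV); apply: (vle_add Phi_MOV) => //; [exact: wL|exact: wL'].
rewrite scalerA; apply: (vscale_unit_le Phi_MOV); exact: ceps.
Qed.

(** Each [a n - s p] with [n] in [K p] should lie below the limit, which is
    therefore taken to be the supremum of one such lower bound for each [p]. *)
Lemma order_complete_limit (a : nat -> X) (s : nat -> X) (K : nat -> set nat) :
  o_sequence s -> (forall p, F (K p)) ->
  (forall p n m, K p n -> K p m -> vabs (a n - a m) <= s p) ->
  exists l, forall p n, K p n -> vabs (a n - l) <= 2 *: s p.
Proof.
move=> /o_sequenceP[_ s0 _] FK aK.
have /choice[n_ Kn] p : exists n, K p n by exact: filter_ex (FK p).
have apart p q n : K p n -> a (n_ q) - s q <= a n + s p.
  move=> Kpn; have [m [Kpm Kqm]] := filter_ex (filterI (FK p) (FK q)).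
  apply/(Phi_le Phi_MOV) => w.
  move/(Phi_le Phi_MOV)/(_ w): (aK _ _ _ Kpn Kpm).
  move/(Phi_le Phi_MOV)/(_ w): (aK _ _ _ (Kn q) Kqm).
  by rewrite !(PhiE Phi_MOV) !ler_norml => /andP[? ?] /andP[? ?]; lra.
have [||l [ubl lub]] := X_complete (S := range (fun q => a (n_ q) - s q)).
- by exists (a (n_ 0%N) - s 0%N); exists 0%N.
- by exists (a (n_ 0%N) + s 0%N) => _ [q _ <-]; exact: apart (Kn 0%N).
exists l => p n Kpn.
have /(Phi_le Phi_MOV) up : l <= a n + s p.
  by apply: lub => _ [q _ <-]; exact: apart.
have /(Phi_le Phi_MOV) lo : a (n_ p) - s p <= l by apply: ubl; exists p.
have /(Phi_le Phi_MOV) an := aK _ _ _ (Kn p) Kpn.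
have /(Phi_le Phi_MOV) sp := s0 p.
apply/(Phi_le Phi_MOV) => w; move: (up w) (lo w) (an w) (sp w).
by rewrite !(PhiE Phi_MOV) !ler_norml => ? ? /andP[? ?] ?; apply/andP; split; lra.
Qed.

(** The supremum over [A] in the definition exists because all the integrals
    over subsets are dominated by those over the whole space. *)
Lemma vitali_seq_defining u f : vitali_seq e mu F u f -> defining_sequence e mu F u f.
Proof.
move=> uf; have [Lu ac cv] := uf.
have [s [K [os FK sK]]] := vitali_seq_close uf uf.
have /choice[l lP] (A : set G) : exists l, measurable A -> forall p n, K p n ->
    vabs (simple_integral_on mu A (u n) - l) <= 2 *: s p.
  have [mA|nmA] := pselect (measurable A); last by exists 0.
  have [|l lP] := order_complete_limit (a := fun n => simple_integral_on mu A (u n)) os FK.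
    by move=> p n m Kn Km; exact: sK.
  by exists l.
have o2s : o_sequence (fun p => 2 *: s p) by exact: (o_sequenceZ Phi_MOV).
pose D n := [set y | exists2 A : set G, measurable A &
  y = vabs (simple_integral_on mu A (u n) - l A)].
have [n0 Kn0] := filter_ex (FK 0%N).
have iota_on A n : measurable A ->
    vabs (simple_integral_on mu A (u n)) <= iota_ mu (u n).
  move=> mA; have LA := Lstar_frestr mA (Lu n).
  apply: (le_trans (simple_integral_vabs Phi_MOV LA)).
  have -> : u n = frestr setT (u n).
    by apply/funext => t; rewrite frestrE in_setT scale1r.
  rewrite (_ : frestr A (frestr _ _) = frestr A (u n)).
    by apply: (iota_frestr_sub Phi_MOV) => //; exact: measurableT.
  by apply/funext => t; rewrite !frestrE in_setT scale1r.
have /choice[S supS] n : exists S, supremums (D n) S.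
  apply: X_complete; first by exists (vabs (simple_integral_on mu set0 (u n) - l set0)), set0.
  exists (iota_ mu (u n) + (iota_ mu (u n0) + 2 *: s 0%N)) => _ [A mA ->].
  have /(Phi_le Phi_MOV) h1 := iota_on A n mA.
  have /(Phi_le Phi_MOV) h2 := iota_on A n0 mA.
  have /(Phi_le Phi_MOV) h3 := lP A mA _ _ Kn0.
  apply/(Phi_le Phi_MOV) => w; move: (h1 w) (h2 w) (h3 w).
  rewrite !(PhiE Phi_MOV) !ler_norml => /andP[? ?] /andP[? ?] /andP[? ?].
  by apply/andP; split; lra.
exists l; split=> //; [exact/(eacP Phi_MOV)|exact/(cvmP Phi_MOV)|].
exists S => //; exists (fun p => 2 *: s p) => // p.
apply: filterS (FK p) => n Kn /=; rewrite subr0.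
have [ubS lubS] := supS n.
have S2 : S n <= 2 *: s p by apply: lubS => _ [A mA ->]; exact: lP.
have S0 : 0 <= S n.
  have := ubS (vabs (simple_integral_on mu set0 (u n) - l set0)).
  by move=> /(_ _)/(le_trans (vabs_ge0 Phi_MOV _)); apply; exists set0.
apply/(Phi_le Phi_MOV) => w; rewrite (Phi_vabs Phi_MOV) ger0_norm.
  exact: (Phi_le Phi_MOV _ _).1.
by rewrite -(Phi0 Phi_MOV w); exact: (Phi_le Phi_MOV _ _).1.
Qed.

Lemma defining_seq_vitali u f : defining_sequence e mu F u f -> vitali_seq e mu F u f.
Proof.
by move=> [l [Lu ac cv _]]; split=> //; [exact/(eacP Phi_MOV)|exact/(cvmP Phi_MOV)].
Qed.

(** The value chosen by [pos_integral] comes from some defining sequence, which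
    [vitali_seq_close] compares with the given one. *)
Lemma pos_integral_lim u f : vitali_seq e mu F u f ->
  oF_lim F (fun n => simple_integral mu (u n)) (pos_integral e mu F [set: G] f).
Proof.
move=> uf; have [l0 l0P] := vitali_seq_defining uf.
have /(xgetPex 0) [v [l [vl lE]]] : exists x, exists (v : nat -> G -> X) (l : set G -> X),
    defines e mu F v f l /\ l [set: G] = x by exists (l0 setT), u, l0.
have vf : vitali_seq e mu F v f by apply: defining_seq_vitali; exists l.
have [_ _ _ [S supS [r or rS]]] := vl.
have [s [K [os FK sK]]] := vitali_seq_close uf vf.
have onT g : simple_integral_on mu setT g = simple_integral mu g.
  by congr simple_integral; apply/funext => t; rewrite frestrE in_setT scale1r.
exists (fun p => s p + r p); first exact: (o_sequenceD Phi_MOV).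
move=> p; have [m [Km rm]] := filter_ex (filterI (FK p) (rS p)).
apply: filterS (FK p) => n Kn /=.
apply: (le_trans (vabs_dist Phi_MOV _ (simple_integral mu (v m)) _)).
apply: (vle_add Phi_MOV).
  by have := sK _ _ _ _ Kn Km measurableT; rewrite !onT.
have [ubS _] := supS m.
apply: (@le_trans _ _ (S m)).
  by rewrite /pos_integral -lE -onT; apply: ubS; exists setT => //; exact: measurableT.
apply: le_trans rm; rewrite subr0; apply/(Phi_le Phi_MOV) => w.
by rewrite !(PhiE Phi_MOV) ler_norm.
Qed.

End vitali.

(** * Power inequalities in the reals *)

(** Convexity of powers by induction: the error committed at each step is
    a b (x - y) (x^p - y^p) >= 0. *)
Lemma exprn_convex (R : realFieldType) (a b x y : R) (p : nat) :
  0 <= a -> 0 <= b -> a + b = 1 -> 0 <= x -> 0 <= y ->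
  (a * x + b * y) ^+ p <= a * x ^+ p + b * y ^+ p.
Proof.
move=> a0 b0 ab1 x0 y0; elim: p => [|p IHp]; first by rewrite !expr0 !mulr1 ab1.
have c0 : 0 <= a * x + b * y by rewrite addr_ge0 ?mulr_ge0.
rewrite exprS; apply: (le_trans (ler_wpM2l c0 IHp)).
have xy : 0 <= (x - y) * (x ^+ p - y ^+ p).
  have [xy|/ltW xy] := leP x y.
    by rewrite mulr_le0 ?subr_le0// lerXn2r.
  by rewrite mulr_ge0 ?subr_ge0// lerXn2r.
have := mulr_ge0 (mulr_ge0 a0 b0) xy; rewrite -subr_ge0 => h.
rewrite -subr_ge0; apply: (le_trans h); rewrite le_eqVlt; apply/orP; left.
have -> : b = 1 - a by lra.
by rewrite !exprS; apply/eqP; ring.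
Qed.

Lemma exprn_add_le (R : realFieldType) (x y : R) (p : nat) :
  `|(x + y) ^+ p| <= 2 ^+ p * (`|x ^+ p| + `|y ^+ p|).
Proof.
rewrite !normrX; have half0 : 0 <= (2^-1 : R) by rewrite invr_ge0.
have half1 : 2^-1 + 2^-1 = 1 :> R by lra.
have := exprn_convex p half0 half0 half1 (normr_ge0 x) (normr_ge0 y).
rewrite -!mulrDr exprMn exprVn ler_pdivrMl ?exprn_gt0// => h.
apply: le_trans (lerXn2r _ _ _ (ler_normD x y)) _; rewrite ?nnegrE ?addr_ge0//.
apply: (le_trans h); rewrite ler_wpM2l ?exprn_ge0// ler_piMl ?addr_ge0 ?exprn_ge0//.
lra.
Qed.

Lemma exprn_lipschitz (R : realFieldType) (M : R) (p : nat) : 0 <= M ->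
  exists2 L : R, 0 < L & forall x y, `|x| <= M -> `|y| <= M ->
    `|x ^+ p - y ^+ p| <= L * `|x - y|.
Proof.
move=> M0; elim: p => [|p [L L0 IHp]].
  by exists 1 => // x y _ _; rewrite !expr0 subrr normr0 mul1r.
exists (M * L + M ^+ p + 1) => [|x y xM yM].
  by rewrite ltr_wpDl// addr_ge0 ?exprn_ge0// mulr_ge0// ltW.
have -> : x ^+ p.+1 - y ^+ p.+1 = x * (x ^+ p - y ^+ p) + (x - y) * y ^+ p.
  by rewrite !exprS; ring.
apply: (le_trans (ler_normD _ _)); rewrite !normrM normrX.
have h1 : `|x| * `|x ^+ p - y ^+ p| <= M * (L * `|x - y|).
  by apply: ler_pM => //; exact: IHp.
have h2 : `|x - y| * `|y| ^+ p <= `|x - y| * M ^+ p.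
  by rewrite ler_wpM2l// lerXn2r// nnegrE.
have := normr_ge0 (x - y); lra.
Qed.

(** * The integral as a limit, and closure properties *)

Section integral.
Context {R : realType} {X : vectorLatticeType R} {e : X}.
Context {Omega : topologicalType} {Phi : X -> Omega -> R}.
Context (Phi_MOV : is_MOV_representation e Phi).
Context (X_complete : dedekind_complete X) (e_unit : order_unit e).
Context {d : measure_display} {G : algebraOfSetsType d}.
Context {mu : {content set G -> \bar R}}.
Context {F : set_system nat} {FF : ProperFilter F}.
Implicit Types (f g h : G -> X) (u v w : nat -> G -> X).

(** The dominating sequences [v] and [w] may differ from the sequence [u] that
    converges: for [psi] a power, [u] is the sequence for [f + g], while [v]
    and [w] are those for the powers of [f] and [g]. *)
Lemma vitali_seq_dominated (c : R) (psi : X -> X) u v w f g h :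
  0 < c -> psi 0 = 0 -> locally_lipschitz e psi ->
  (forall n, Lstar mu (u n)) -> cvm e mu F u f ->
  vitali_seq e mu F v g -> vitali_seq e mu F w h ->
  (forall n t, vabs (psi (u n t)) <= c *: (vabs (v n t) + vabs (w n t))) ->
  vitali_seq e mu F (fun n t => psi (u n t)) (fun t => psi (f t)).
Proof.
move=> c0 psi0 lpsi Lu uf [Lv acv _] [Lw acw _] dom.
have Lpsi n : Lstar mu (fun t => psi (u n t)) by exact: Lstar_comp.
split=> //; first exact: (eac_dom Phi_MOV c0 Lv Lw Lpsi dom).
exact: (cvm_comp Phi_MOV).
Qed.

Lemma vitali_seq_comp (psi : X -> X) u f :
  (forall x, vabs (psi x) <= vabs x) -> locally_lipschitz e psi ->
  vitali_seq e mu F u f ->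
  vitali_seq e mu F (fun n t => psi (u n t)) (fun t => psi (f t)).
Proof.
move=> psi_le lpsi uf; have [Lu _ cu] := uf.
have psi0 : psi 0 = 0.
  apply: (Phi_eq Phi_MOV) => t; rewrite (Phi0 Phi_MOV); apply/eqP; rewrite -normr_le0.
  move/(Phi_le Phi_MOV)/(_ t): (psi_le 0).
  by rewrite !(PhiE Phi_MOV) normr0.
apply: (vitali_seq_dominated (ltr01 : 0 < (1 : R)) psi0 lpsi Lu cu uf uf) => n t.
rewrite scale1r; apply: (le_trans (psi_le _)); rewrite -[leLHS]addr0.
by apply: (vle_add Phi_MOV) => //; exact: (vabs_ge0 Phi_MOV).
Qed.

Lemma vitali_seqD u v f g : vitali_seq e mu F u f -> vitali_seq e mu F v g ->
  vitali_seq e mu F (fun n t => u n t + v n t) (fun t => f t + g t).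
Proof.
move=> [Lu acu cu] [Lv acv cv].
have LD n : Lstar mu (fun t => u n t + v n t).
  by apply: (Lstar_comp2 (psi := +%R) _ (Lu n) (Lv n)); exact: addr0.
split=> //; last exact: (cvm_add Phi_MOV).
apply: (eac_dom Phi_MOV (ltr01 : 0 < (1 : R)) Lu Lv LD _ acu acv) => n t.
by apply/(Phi_le Phi_MOV) => w; rewrite !(PhiE Phi_MOV) mul1r ler_normD.
Qed.

Lemma locally_lipschitz1 (psi : X -> X) :
  (forall x y, vabs (psi x - psi y) <= vabs (x - y)) -> locally_lipschitz e psi.
Proof. by move=> psiL M _; exists 1 => // x y _ _; rewrite scale1r. Qed.

Lemma locally_lipschitz_vexp p : locally_lipschitz e (fun x => vexp e Phi x p).
Proof.
move=> M M0; have [L L0 expL] := exprn_lipschitz p M0; exists L => // x y.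
move=> /(Phi_le Phi_MOV) xM /(Phi_le Phi_MOV) yM; apply/(Phi_le Phi_MOV) => w.
move: (xM w) (yM w); rewrite !(PhiE Phi_MOV) !mulr1; exact: expL.
Qed.

Lemma vitali_seq_vpos u f : vitali_seq e mu F u f ->
  vitali_seq e mu F (fun n t => vpos (u n t)) (fun t => vpos (f t)).
Proof.
apply: vitali_seq_comp => [x|]; last apply: locally_lipschitz1 => x y;
  apply/(Phi_le Phi_MOV) => w; rewrite !(PhiE Phi_MOV).
  by case: (leP (Phi x w) 0) => h; rewrite ?normr0.
case: (leP (Phi x w) 0); case: (leP (Phi y w) 0) => hy hx;
  rewrite ?subrr ?normr0// ?subr0 ?sub0r ?normrN.
  by rewrite distrC !ger0_norm ?subr_ge0 ?(ltW hy)//; lra.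
by rewrite !ger0_norm ?subr_ge0 ?(ltW hx)//; lra.
Qed.

Lemma vitali_seqN u f : vitali_seq e mu F u f ->
  vitali_seq e mu F (fun n t => - u n t) (fun t => - f t).
Proof.
apply: vitali_seq_comp => [x|]; last apply: locally_lipschitz1 => x y;
  apply/(Phi_le Phi_MOV) => w; rewrite !(PhiE Phi_MOV) ?normrN//.
by rewrite -opprD normrN.
Qed.

Lemma vitali_seq_integrable u f :
  vitali_seq e mu F u f -> vintegrable e mu F f.
Proof.
have pos g : (exists v, vitali_seq e mu F v g) ->
    pos_integrable e mu F (fun t => vpos (g t)).
  move=> [v vg]; split=> [t|].
    by apply/(Phi_le Phi_MOV) => w; rewrite !(PhiE Phi_MOV) le_max lexx orbT.
  by eexists; apply: (vitali_seq_defining Phi_MOV X_complete); exact: vitali_seq_vpos vg.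
move=> uf; split; apply: pos; first by exists u.
by eexists; exact: vitali_seqN uf.
Qed.

(** The integral of a function of arbitrary sign is defined through two
    separate choices of sequences for its positive and negative parts; they can
    be replaced by the parts of one sequence. *)
Lemma vintegral_lim u f : vitali_seq e mu F u f ->
  oF_lim F (fun n => simple_integral mu (u n)) (vintegral e mu F [set: G] f).
Proof.
move=> uf; have up := vitali_seq_vpos uf; have un := vitali_seq_vpos (vitali_seqN uf).
have lp := pos_integral_lim Phi_MOV X_complete (FF := FF) up.
have ln := pos_integral_lim Phi_MOV X_complete (FF := FF) un.
have := oF_limD Phi_MOV lp (oF_limZ Phi_MOV (-1) ln).
rewrite scaleN1r; have -> : (fun n => simple_integral mu (fun t => vpos (u n t)) +
    (-1) *: simple_integral mu (fun t => vpos (- u n t))) =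
  fun n => simple_integral mu (u n); last exact.
apply/funext => n; rewrite scaleN1r.
have [[Lp _ _] [Ln _ _]] := (up, un).
rewrite -simple_integralB//; congr simple_integral; apply/funext => t.
apply: (Phi_eq Phi_MOV) => w; rewrite !(PhiE Phi_MOV).
have [h|h] := leP (Phi (u n t) w) 0.
  by rewrite max_l ?oppr_ge0// sub0r opprK.
by rewrite max_r ?oppr_le0 ?(ltW h)// subr0.
Qed.

(** Monotonicity is applied to simple functions only, so that no inequality
    between the limit functions has to be carried through the integral. *)
Lemma vintegral_le_lin (a b : R) u v w f g h :
  vitali_seq e mu F u f -> vitali_seq e mu F v g -> vitali_seq e mu F w h ->
  (forall n t, w n t <= a *: u n t + b *: v n t) ->
  vintegral e mu F [set: G] h <=
    a *: vintegral e mu F [set: G] f + b *: vintegral e mu F [set: G] g.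
Proof.
move=> uf vg wh le_w.
apply: (oF_lim_le Phi_MOV _ (vintegral_lim wh)
  (oF_limD Phi_MOV (oF_limZ Phi_MOV a (vintegral_lim uf))
                   (oF_limZ Phi_MOV b (vintegral_lim vg)))) => n.
have [[Lu _ _] [Lv _ _] [Lw _ _]] := And3 uf vg wh.
rewrite -simple_integral_lin//; apply: (simple_integral_le Phi_MOV) => //.
apply: (Lstar_comp2 (psi := fun x y => a *: x + b *: y) _ (Lu n) (Lv n)).
by rewrite !scaler0 addr0.
Qed.

Lemma vitali_seq_abs_exp (a : R) p u f : 0 < a -> (0 < p)%N ->
  vitali_seq e mu F u f ->
  vitali_seq e mu F (fun n t => vexp e Phi (u n t) p) (fun t => vexp e Phi (f t) p) ->
  vitali_seq e mu F (fun n t => vexp e Phi (a^-1 *: vabs (u n t)) p)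
                    (fun t => vexp e Phi (a^-1 *: vabs (f t)) p).
Proof.
move=> a0 p0 [Lu _ uf] upf; have a'0 : 0 < a^-1 by rewrite invr_gt0.
have exp0 : vexp e Phi 0 p = 0.
  by apply: (Phi_eq Phi_MOV) => w; rewrite !(PhiE Phi_MOV) expr0n gtn_eqF.
have abs0 : a^-1 *: vabs (0 : X) = 0.
  by apply: (Phi_eq Phi_MOV) => w; rewrite !(PhiE Phi_MOV) normr0 mulr0.
have Labs n : Lstar mu (fun t => a^-1 *: vabs (u n t)).
  exact: (Lstar_comp (psi := fun x => a^-1 *: vabs x)).
have cabs : cvm e mu F (fun n t => a^-1 *: vabs (u n t)) (fun t => a^-1 *: vabs (f t)).
  apply: (cvm_comp Phi_MOV e_unit (psi := fun x => a^-1 *: vabs x) Lu) uf.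
  move=> M _; exists a^-1 => // x y _ _; apply/(Phi_le Phi_MOV) => w.
  rewrite !(PhiE Phi_MOV) -mulrBr normrM (gtr0_norm a'0) ler_wpM2l ?(ltW a'0)//.
  exact: ler_dist_dist.
have c0 : 0 < a^-1 ^+ p by rewrite exprn_gt0.
apply: (vitali_seq_dominated c0 exp0 (locally_lipschitz_vexp p) Labs cabs upf upf) => n t.
apply/(Phi_le Phi_MOV) => w; rewrite !(PhiE Phi_MOV) exprMn normrM.
rewrite (gtr0_norm c0) ler_wpM2l ?(ltW c0)// !normrX normr_id lerDl.
by rewrite exprn_ge0.
Qed.

(** The set of admissible radii, whose infimum is the norm. *)
Definition norm_bounds (p : nat) f : set R := [set eps : R | 0 < eps /\
  vintegral e mu F [set: G]
    (fun t => vexp e Phi (eps^-1 *: vabs (f t)) p) <= e].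

(** The infimum of an empty set would be 0, hence the need for this lemma.  For
    [a >= 1] one has (x / a)^p <= x^p / a, so a bound [c *: e] on the integral
    of |f|^p makes [max 1 c] admissible. *)
Lemma norm_bounds_nonempty p u f : (0 < p)%N ->
  vitali_seq e mu F u f ->
  vitali_seq e mu F (fun n t => vexp e Phi (u n t) p) (fun t => vexp e Phi (f t) p) ->
  norm_bounds p f !=set0.
Proof.
move=> p0 uf upf; have abs_exp a a0 := vitali_seq_abs_exp (a := a) a0 p0 uf upf.
pose I1 := vintegral e mu F [set: G] (fun t => vexp e Phi (1^-1 *: vabs (f t)) p).
have [c c0 I1c] := e_unit I1; pose a := Num.max 1 c.
have a1 : 1 <= a by rewrite le_max lexx.
have a0 : 0 < a by exact: lt_le_trans a1.
exists a; split=> //.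
have := vintegral_le_lin (a := a^-1) (b := 0) (abs_exp 1 ltr01) (abs_exp 1 ltr01) (abs_exp a a0).
rewrite scale0r addr0 -/I1 => le_I; apply: le_trans (le_I _) _.
  move=> n t; apply/(Phi_le Phi_MOV) => w; rewrite !(PhiE Phi_MOV) mul0r addr0.
  rewrite invr1 mul1r exprMn ler_wpM2r ?exprn_ge0//.
  have a'0 : 0 <= a^-1 by rewrite invr_ge0 ltW.
  have a'1 : a^-1 <= 1 by rewrite invf_le1.
  case: p p0 {uf upf abs_exp I1 I1c le_I} => // p _.
  by rewrite exprS ler_piMr// exprn_ile1.
apply/(Phi_le Phi_MOV) => w; move/(Phi_le Phi_MOV)/(_ w): I1c.
rewrite !(PhiE Phi_MOV) mulr1 => /(le_trans (ler_norm _)) Ic.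
rewrite ler_pdivrMl// mulr1; apply: (le_trans Ic).
by rewrite le_max lexx orbT.
Qed.

Lemma norm_boundsD p u v f g (a b : R) : (0 < p)%N ->
  vitali_seq e mu F u f ->
  vitali_seq e mu F (fun n t => vexp e Phi (u n t) p) (fun t => vexp e Phi (f t) p) ->
  vitali_seq e mu F v g ->
  vitali_seq e mu F (fun n t => vexp e Phi (v n t) p) (fun t => vexp e Phi (g t) p) ->
  vitali_seq e mu F (fun n t => vexp e Phi (u n t + v n t) p)
    (fun t => vexp e Phi (f t + g t) p) ->
  norm_bounds p f a -> norm_bounds p g b ->
  norm_bounds p (fun t => f t + g t) (a + b).
Proof.
move=> p0 uf upf vg vpg wph [a0 fa] [b0 gb].
have ab0 : 0 < a + b by rewrite addr_gt0.
have [al0 be0] : 0 <= a / (a + b) /\ 0 <= b / (a + b).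
  by split; apply: divr_ge0; exact: ltW.
have albe : a / (a + b) + b / (a + b) = 1 by rewrite -mulrDl divff// gt_eqF.
split=> //; have := vintegral_le_lin (a := a / (a + b)) (b := b / (a + b))
  (vitali_seq_abs_exp a0 p0 uf upf) (vitali_seq_abs_exp b0 p0 vg vpg)
  (vitali_seq_abs_exp ab0 p0 (vitali_seqD uf vg) wph).
move=> le_I; apply: le_trans (le_I _) _ => [n t|].
  apply/(Phi_le Phi_MOV) => w; rewrite !(PhiE Phi_MOV).
  set x := `|Phi (u n t) w|; set y := `|Phi (v n t) w|.
  have [x0 y0] : 0 <= a^-1 * x /\ 0 <= b^-1 * y.
    by split; apply: mulr_ge0; rewrite ?invr_ge0 ?(ltW a0) ?(ltW b0) ?normr_ge0.
  apply: le_trans (exprn_convex p al0 be0 albe x0 y0).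
  apply: lerXn2r; rewrite ?nnegrE.
  - by rewrite mulr_ge0// invr_ge0 ltW.
  - by apply: addr_ge0; apply: mulr_ge0.
  have -> : a / (a + b) * (a^-1 * x) + b / (a + b) * (b^-1 * y) = (a + b)^-1 * (x + y).
    by field; rewrite !gt_eqF.
  by rewrite ler_wpM2l ?invr_ge0 ?(ltW ab0)// ler_normD.
apply: le_trans (vle_add Phi_MOV (vle_scale Phi_MOV al0 fa) (vle_scale Phi_MOV be0 gb)) _.
by rewrite -scalerDl albe scale1r.
Qed.

End integral.

(** * Minkowski's inequality *)

Lemma inf_add_le (R : realType) (A B C : set R) :
  A !=set0 -> B !=set0 -> has_lbound C ->
  (forall a b, A a -> B b -> C (a + b)) -> inf C <= inf A + inf B.
Proof.
move=> A0 B0 C0 ABC; rewrite -lerBlDr; apply: lb_le_inf => // a Aa.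
rewrite lerBlDr addrC -lerBlDr; apply: lb_le_inf => // b Bb.
by rewrite lerBlDr addrC; apply: ge_inf => //; exact: ABC.
Qed.

Theorem proposition3p7
  (R : realType) (X : vectorLatticeType R) (e : X)
  (Omega : topologicalType) (Phi : X -> Omega -> R)
  (d : measure_display) (G : algebraOfSetsType d)
  (mu : {content set G -> \bar R}) (F : set_system nat)
  (X_complete : dedekind_complete X)
  (e_unit : order_unit e)
  (Omega_compact : compact [set: Omega])
  (Omega_hausdorff : hausdorff_space Omega)
  (Omega_ed : extremely_disconnected Omega)
  (Phi_MOV : is_MOV_representation e Phi)
  (G_infinite : infinite_set [set: G])
  (F_free : free_filter F)
  (p : nat) (p_gt0 : (0 < p)%N)
  (f g : G -> X)
  (f_Lp : in_Lp e Phi mu F p f) (g_Lp : in_Lp e Phi mu F p g) :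
  in_Lp e Phi mu F p (fun t => f t + g t) /\
  Lp_norm e Phi mu F p (fun t => f t + g t)
    <= Lp_norm e Phi mu F p f + Lp_norm e Phi mu F p g.
Proof.
have [FF _] := F_free.
have [_ _ [u [/(defining_seq_vitali Phi_MOV) uf /(defining_seq_vitali Phi_MOV) upf]]] := f_Lp.
have [_ _ [v [/(defining_seq_vitali Phi_MOV) vg /(defining_seq_vitali Phi_MOV) vpg]]] := g_Lp.
have wh := vitali_seqD Phi_MOV (FF := FF) uf vg.
have wph : vitali_seq e mu F (fun n t => vexp e Phi (u n t + v n t) p)
    (fun t => vexp e Phi (f t + g t) p).
  have [Lw _ cw] := wh; have c0 : 0 < (2 ^+ p : R) by rewrite exprn_gt0.
  apply: (vitali_seq_dominated Phi_MOV e_unit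
    (psi := fun x => vexp e Phi x p) c0 _ _ Lw cw upf vpg).
  - by apply: (Phi_eq Phi_MOV) => w; rewrite !(PhiE Phi_MOV) expr0n gtn_eqF.
  - exact: locally_lipschitz_vexp.
  move=> n t; apply/(Phi_le Phi_MOV) => w; rewrite !(PhiE Phi_MOV).
  exact: exprn_add_le.
split.
  split.
  - exact: (vitali_seq_integrable Phi_MOV X_complete e_unit wh).
  - exact: (vitali_seq_integrable Phi_MOV X_complete e_unit wph).
  exists (fun n t => u n t + v n t).
  by split; apply: (vitali_seq_defining Phi_MOV X_complete).
apply: inf_add_le.
- exact: (norm_bounds_nonempty Phi_MOV X_complete e_unit p_gt0 uf upf).
- exact: (norm_bounds_nonempty Phi_MOV X_complete e_unit p_gt0 vg vpg).
- by exists 0 => a [/ltW].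
move=> a b fa gb.
exact: (norm_boundsD Phi_MOV X_complete e_unit p_gt0 uf upf vg vpg wph fa gb).
Qed.
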